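(* Let $N\ge 1$, let $k_1,\ldots,k_N\in\mathbf{Z}$, and let $\mathcal{L}$ be the cost function with starting locations $x_i = k_i$, $i=1,\ldots,N$. Let $x^\ast\in\mathbf{R}$ be a minimizer of $\mathcal{L}$ over $\mathbf{R}$, i.e. $\mathcal{L}(x^\ast)\le \mathcal{L}(x)$ for all $x\in\mathbf{R}$. Let $k^- = \lfloor x^\ast\rfloor$ be the largest integer smaller than or equal to $x^\ast$, and let $k^+ = \lceil x^\ast\rceil$ be the smallest integer larger than or equal to $x^\ast$. If $$k^\ast = \arg\min_{k\in\{k^-,\,k^+\}} \mathcal{L}(k)$$ (i.e. $k^\ast\in\{k^-,k^+\}$ is a minimizer of $\mathcal{L}$ over $\{k^-,k^+\}$), then $k^\ast$ is a minimizer of $\mathcal{L}$ over $\mathbf{Z}$, i.e. $\mathcal{L}(k^\ast)\le\mathcal{L}(k)$ for all $k\in\mathbf{Z}$.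
   Context: For starting locations $x_1,\ldots,x_N\in\mathbf{R}$, the cost function is $\mathcal{L}(x) = \sum_{i=1}^N f(|x-x_i|)$ for $x\in\mathbf{R}$, where $f(d)=\frac{d(d+1)}{2}$; that is, $\mathcal{L}(x) = \frac12\sum_{i=1}^N\left[(x-x_i)^2+|x-x_i|\right]$. *)

(* Defs.v *)
From mathcomp Require Import all_boot all_order all_algebra.
From mathcomp Require Import reals.

Set Implicit Arguments.
Unset Strict Implicit.
Unset Printing Implicit Defensive.

Import Order.TTheory GRing.Theory Num.Theory.
Local Open Scope ring_scope.

Definition fuel (R : realType) (d : R) : R := d * (d + 1) / 2.

Definition cost (R : realType) (N : nat) (x_ : 'I_N -> R) (x : R) : R :=
  \sum_(i < N) fuel `|x - x_ i|.

(* Main.v *)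
(* The cost function is convex, so it is monotone on each side of a minimizer;
   an integer k <= xstar satisfies k <= floor xstar <= xstar, hence
   L (floor xstar) <= L k, and symmetrically with the ceiling. *)
Require Import Defs.
From mathcomp Require Import all_boot all_order all_algebra.
From mathcomp Require Import reals.
From mathcomp Require Import ring.

Set Implicit Arguments.
Unset Strict Implicit.
Unset Printing Implicit Defensive.

Import Order.TTheory GRing.Theory Num.Theory.
Local Open Scope ring_scope.

Lemma le_fuel (R : realType) (c d : R) : 0 <= c -> c <= d -> fuel c <= fuel d.
Proof.
move=> c_ge0 cd; rewrite /fuel ler_pM2r ?invr_gt0 ?ltr0n //.
by apply: ler_pM => //; rewrite ?addr_ge0 ?lerD2r.
Qed.

(** [fuel] is quadratic with leading coefficient 1/2, so its linear part cancels from the convexity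
    gap, leaving a nonnegative multiple of [(c - d) ^+ 2]. *)
Lemma fuel_convex (R : realType) (t c d : R) : 0 <= t -> t <= 1 ->
  fuel (t * c + (1 - t) * d) <= t * fuel c + (1 - t) * fuel d.
Proof.
move=> t_ge0 t_le1; rewrite -subr_ge0.
have -> : t * fuel c + (1 - t) * fuel d - fuel (t * c + (1 - t) * d) =
          t * (1 - t) * (c - d) ^+ 2 / 2 by rewrite /fuel; field.
by rewrite divr_ge0 // mulr_ge0 ?sqr_ge0 // mulr_ge0 // subr_ge0.
Qed.

(** Termwise: the triangle inequality bounds the distance to [x_ i] by the weighted distances, then
    [fuel] is monotone on nonnegative reals and convex. *)
Lemma cost_convex (R : realType) (N : nat) (x_ : 'I_N -> R) (t x y : R) :
  0 <= t -> t <= 1 ->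
  cost x_ (t * x + (1 - t) * y) <= t * cost x_ x + (1 - t) * cost x_ y.
Proof.
move=> t_ge0 t_le1; rewrite /cost !mulr_sumr -big_split /=.
apply: ler_sum => i _; apply: le_trans (fuel_convex _ _ t_ge0 t_le1).
apply: le_fuel => //.
have -> : t * x + (1 - t) * y - x_ i =
          t * (x - x_ i) + (1 - t) * (y - x_ i) by ring.
by rewrite (le_trans (ler_normD _ _)) // !normrM (ger0_norm t_ge0)
  (@ger0_norm _ (1 - t)) ?subr_ge0.
Qed.

(** A convex combination of the costs at [x] and [y] cannot exceed the larger one, at [y]. The two
    orderings serve integers on either side of the minimizer. *)
Lemma cost_between (R : realType) (N : nat) (x_ : 'I_N -> R) (x y z : R) :
  cost x_ x <= cost x_ y -> x <= z <= y \/ y <= z <= x ->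
  cost x_ z <= cost x_ y.
Proof.
move=> cxy zxy; have [xy|nxy] := eqVneq x y.
  suff -> : z = y by rewrite lexx.
  by apply/le_anti; rewrite xy in zxy; case: zxy => /andP[h1 h2]; rewrite h1 h2.
have [t [t_ge0 t_le1 ->]] :
    exists t, [/\ 0 <= t, t <= 1 & z = t * x + (1 - t) * y].
  (* Solves [z = t * x + (1 - t) * y] for [t]; the division is why [x = y] was treated apart. *)
  exists ((z - y) / (x - y)).
  have dxy : x - y != 0 by rewrite subr_eq0.
  split; last by field.
  - case: zxy => /andP[h1 h2]; last by rewrite divr_ge0 // subr_ge0 // (le_trans h1).
    by rewrite -mulrNN -invrN !opprB divr_ge0 // subr_ge0 // (le_trans h1).
  - case: zxy => /andP[h1 h2].
      have lt_xy : x < y by rewrite lt_neqAle nxy (le_trans h1).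
      by rewrite ler_ndivrMr ?subr_lt0 // mul1r lerD2r.
    have lt_yx : y < x by rewrite lt_neqAle eq_sym nxy (le_trans h1).
    by rewrite ler_pdivrMr ?subr_gt0 // mul1r lerD2r.
apply: le_trans (cost_convex _ _ _ t_ge0 t_le1) _.
rewrite -lerBrDr; apply: le_trans (ler_wpM2l t_ge0 cxy) _.
by rewrite mulrBl mul1r opprB addrC subrK.
Qed.

Theorem theorem5 (R : realType) (N : nat) (hN : (1 <= N)%N) (k_ : 'I_N -> int)
    (L : R -> R) (hL : L = cost (fun i => (k_ i)%:~R))
    (xstar : R) (hxstar : forall x : R, L xstar <= L x)
    (kstar : int) (hmem : kstar \in [:: Num.floor xstar; Num.ceil xstar])
    (hkstar : forall k : int, k \in [:: Num.floor xstar; Num.ceil xstar] ->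
       L kstar%:~R <= L k%:~R) :
  forall k : int, L kstar%:~R <= L k%:~R.
Proof.
move=> k; have [kx|xk] := lerP k%:~R xstar.
  apply: (le_trans (hkstar (Num.floor xstar) _)); first by rewrite !inE eqxx.
  (* Here [xstar] plays [x], the integer [k] plays [y], and the floor is the point [z] between
     them. *)
  move: (hxstar k%:~R); rewrite hL => /cost_between; apply; right.
  by rewrite ler_int floor_ge_int kx floor_le.
apply: (le_trans (hkstar (Num.ceil xstar) _)); first by rewrite !inE eqxx orbT.
move: (hxstar k%:~R); rewrite hL => /cost_between; apply; left.
by rewrite ler_int ceil_le_int (ltW xk) ceil_ge.
Qed.
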